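(* Let $K$ be a field and let $\gamma:F\to F'$ be a morphism of finitely generated free bipersistence modules, represented by an $m\times n$ bigraded matrix $[\gamma]$ with respect to ordered bases $B$ of $F$ and $B'$ of $F'$. Then the list output by the algorithm $\mathsf{KerBasis}$ on input $[\gamma]$ represents a basis for the (free) module $\ker\gamma$; here an output pair $(v,\mathbf z)\in K^n\times \mathbb Z^2$ represents the element of $F_{\mathbf z}$ whose coordinate vector with respect to $B$ is $v$.
   Context: A bipersistence module is a $K[x_1,x_2]$-module $M$ with a vector space decomposition $M=\bigoplus_{\mathbf z\in\mathbb Z^2}M_{\mathbf z}$ such that $x_iM_{\mathbf z}\subset M_{\mathbf z+\mathbf e_i}$. Morphisms are module homomorphisms preserving grades. $\mathbb Z^2$ carries the product partial order $\le$. A bipersistence module is free if it is isomorphic to a direct sum of modules $Q^{\mathbf g}$, $\mathbf g\in\mathbb Z^2$, where $Q^{\mathbf g}_{\mathbf z}=K$ if $\mathbf g\le\mathbf z$ and $0$ otherwise, with identity maps between the copies of $K$. A basis of a free module is a minimal homogeneous generating set. For a homogeneous element $b$, $\mathrm{gr}(b)$ is its grade. Given an ordered basis $B$ of a finitely generated free module $F$ and $v\in F_{\mathbf z}$, the coordinate vector $[v]^B\in K^{|B|}$ is the unique vector with $[v]^B_i=0$ if $\mathrm{gr}(B_i)\not\le\mathbf z$ and $v=\sum_{i:\mathrm{gr}(B_i)\le \mathbf z}[v]^B_i x^{\mathbf z-\mathrm{gr}(B_i)}B_i$. The matrix $[\gamma]$ has $j$-th column $[\gamma(B_j)]^{B'}$,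 labeled by $\mathrm{gr}(B_j)$. A bigraded matrix is a matrix over $K$ with columns labeled by elements of $\mathbb Z^2$ in colexicographical order (second coordinate compared first); the label of column $j$ of $R$ is $\mathrm{gr}(R)_j$. The pivot $\rho^R_j$ of column $R( *,j)$ is the largest index of a nonzero entry, or $\mathsf{null}$ if the column is zero. Let $S\subset\mathbb Z^2$ be the set of column labels, and $\mathrm{grid}(F)=\{(z_1,z_2): (z_1,y)\in S\text{ and }(x,z_2)\in S\text{ for some }x,y\}$. Algorithm $\mathsf{KerBasis}$. Initialize $R=[\gamma]$, $V=$ the $n\times n$ identity matrix, and an empty output list. For each $\mathbf z=(z_1,z_2)\in\mathrm{grid}(F)$ in lexicographical order (first coordinate compared first), do the following: (1) For each column index $j$ with $\mathrm{gr}(R)_j=(y,z_2)$ for some $y\le z_1$, in increasing order of $j$: while there exists $k<j$ with $\mathrm{gr}(R)_k\le\mathbf z$ and $\mathsf{null}\ne\rho^R_j=\rho^R_k$, add $-\frac{R(\rho^R_j,j)}{R(\rho^R_j,k)}R( *,k)$ to $R( *,j)$, and perform the same column operation on $V$ (add the same multiple of $V( *,k)$ to $V( *,j)$). (2) For each $j$ such that column $R( *,j)$ was first found to be zero in step (1) for this $\mathbf z$ (that is, $j$ is among the indices treated in step (1), $R( *,j)=0$ after step (1), and $j$ was not recorded at an earlier grade), append $(V( *,j),\mathbf z)$ to the output list. *)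

(* Defs.v *)
From HB Require Import structures.
From mathcomp Require Import all_boot all_order all_algebra.
From mathcomp Require Import freeg mpoly.

Set Implicit Arguments.
Unset Strict Implicit.
Unset Printing Implicit Defensive.

Import Order.TTheory GRing.Theory Num.Theory.
Local Open Scope ring_scope.

Definition grade := (int * int)%type.

Definition gle (a b : grade) : bool := (a.1 <= b.1) && (a.2 <= b.2).

Definition lex_le (a b : grade) : bool :=
  (a.1 < b.1) || (a.1 == b.1) && (a.2 <= b.2).

Definition colex_le (a b : grade) : bool :=
  (a.2 < b.2) || (a.2 == b.2) && (a.1 <= b.1).

(* The exponent of x^(z - g), meaningful when [gle g z]; the absolute values
   only serve to land in nat. *)
Definition gdiff (g z : grade) : 'X_{1..2} :=
  [multinom [tuple `|z.1 - g.1|%N; `|z.2 - g.2|%N]].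

(* The pieces of the decomposition are Prop-valued predicates; [piece_span] and
   [piece_indep] say that M is their internal direct sum. *)
Record bipersModule (K : fieldType) := BipersModule {
  bcar :> lmodType {mpoly K[2]};
  piece : grade -> bcar -> Prop;
  piece0 : forall z, piece z 0;
  pieceP : forall z (c : K) u v,
    piece z u -> piece z v -> piece z (c%:MP *: u + v);
  piece_span : forall v : bcar, exists (s : seq grade) (c : grade -> bcar),
    [/\ uniq s, forall z, piece z (c z) & v = \sum_(z <- s) c z];
  piece_indep : forall (s : seq grade) (c : grade -> bcar),
    uniq s -> (forall z, piece z (c z)) -> \sum_(z <- s) c z = 0 ->
    forall z, z \in s -> c z = 0;
  piece_X1 : forall z v, piece z v -> piece (z.1 + 1, z.2) ('X_ord0 *: v);
  piece_X2 : forall z v, piece z v -> piece (z.1, z.2 + 1) ('X_ord_max *: v)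
}.

Record bipersMor (K : fieldType) (M N : bipersModule K) := BipersMor {
  bmor :> {linear M -> N};
  bmor_piece : forall z v, piece z v -> piece z (bmor v)
}.

Definition bipers_iso (K : fieldType) (M N : bipersModule K) : Prop :=
  exists (f : bipersMor M N) (g : bipersMor N M), cancel f g /\ cancel g f.

Section FreeModules.
Variable K : fieldType.

(* The module Q^g is carried by {mpoly K[2]}: the copy of K in grade z >= g is
   the line spanned by x^(z - g), so that multiplication by x1 and x2 is the
   identity between copies of K. *)
Definition Qpiece (g z : grade) (p : {mpoly K[2]}) : Prop :=
  if gle g z then exists c : K, p = c *: 'X_[gdiff g z] else p = 0.

Definition Qproj (g z : grade) (p : {mpoly K[2]}) : {mpoly K[2]} :=
  if gle g z then p@_(gdiff g z) *: 'X_[gdiff g z] else 0.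

Definition gadd (g : grade) (m : 'X_{1..2}) : grade :=
  (g.1 + (m ord0)%:Z, g.2 + (m ord_max)%:Z).

Lemma mnm2P (m m' : 'X_{1..2}) :
  m ord0 = m' ord0 -> m ord_max = m' ord_max -> m = m'.
Proof.
move=> h0 h1; apply/mnmP=> i; case: i => [[|[|//]]] Hi.
  by rewrite (_ : Ordinal Hi = ord0) //; apply/val_inj.
by rewrite (_ : Ordinal Hi = ord_max) //; apply/val_inj.
Qed.

Lemma gdiff0 g z : gdiff g z ord0 = `|z.1 - g.1|%N.
Proof. by []. Qed.

Lemma gdiff1 g z : gdiff g z ord_max = `|z.2 - g.2|%N.
Proof. by []. Qed.

Lemma gdiffE g z : gle g z -> gadd g (gdiff g z) = z.
Proof.
case: z => a b /andP[/= h1 h2]; rewrite /gadd gdiff0 gdiff1 /=.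
by rewrite !gez0_abs ?subr_ge0 // !(addrC _ (_ - _)) !subrK.
Qed.

Lemma gle_gadd g m : gle g (gadd g m).
Proof. by rewrite /gle /= !lerDl. Qed.

Lemma gaddK g m : gdiff g (gadd g m) = m.
Proof.
by apply: mnm2P; rewrite ?gdiff0 ?gdiff1 /= addrAC subrr add0r.
Qed.

Lemma Qproj_piece g z p : Qpiece g z (Qproj g z p).
Proof.
by rewrite /Qpiece /Qproj; case: (gle g z) => //; exists (p@_(gdiff g z)).
Qed.

Lemma QprojE g z p : Qpiece g z p -> Qproj g z p = p.
Proof.
rewrite /Qpiece /Qproj; case: ifP => // _ [c ->].
by rewrite mcoeffZ mcoeffX eqxx mulr1.
Qed.

Lemma Qproj0 g z : Qproj g z 0 = 0.
Proof. by rewrite /Qproj mcoeff0 scale0r if_same. Qed.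

Lemma QprojD g z p q : Qproj g z (p + q) = Qproj g z p + Qproj g z q.
Proof. by rewrite /Qproj; case: ifP; rewrite ?addr0 // mcoeffD scalerDl. Qed.

Lemma Qproj_neq g z z' p : Qpiece g z' p -> z' != z -> Qproj g z p = 0.
Proof.
rewrite /Qpiece /Qproj; case: ifP => h'; last by move=> -> _; rewrite mcoeff0 scale0r if_same.
case=> c -> ne; case: ifP => // h; rewrite mcoeffZ mcoeffX.
case: eqP => [e|]; last by rewrite mulr0 scale0r.
by case/eqP: ne; rewrite -(gdiffE h) -(gdiffE h') e.
Qed.

Lemma Qproj_sum g p s : uniq s ->
  {subset [seq gadd g m | m <- msupp p] <= s} ->
  p = \sum_(z <- s) Qproj g z p.
Proof.
move=> us sub; rewrite (bigID (mem [seq gadd g m | m <- msupp p])) /=.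
rewrite [X in _ + X]big1_seq ?addr0; last first.
  move=> z /andP[nz _]; rewrite /Qproj; case: ifP => // h.
  rewrite (_ : p@__ = 0) ?scale0r //; apply/eqP; rewrite mcoeff_eq0.
  by apply: contra nz => hm; apply/mapP; exists (gdiff g z) => //; rewrite gdiffE.
rewrite -big_filter (perm_big [seq gadd g m | m <- msupp p]); last first.
  apply: uniq_perm.
  - exact: filter_uniq.
  - rewrite map_inj_uniq ?msupp_uniq // => m m' e.
    by rewrite -(gaddK g m) e gaddK.
  move=> z; rewrite mem_filter /=.
  by case: (boolP (z \in map _ _)) => //= /sub ->.
rewrite big_map [LHS]mpolyE; apply: eq_bigr => m _.
by rewrite /Qproj gle_gadd gaddK.
Qed.

Lemma Qpiece0 g z : Qpiece g z 0.
Proof. by rewrite /Qpiece; case: ifP => // _; exists 0; rewrite scale0r. Qed.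

Lemma QpieceP g z (c : K) p q :
  Qpiece g z p -> Qpiece g z q -> Qpiece g z (c%:MP * p + q).
Proof.
rewrite /Qpiece; case: ifP => _; last by move=> -> ->; rewrite mulr0 addr0.
by move=> [a ->] [b ->]; exists (c * a + b); rewrite mul_mpolyC scalerA scalerDl.
Qed.

Lemma Qpiece_X1 g z p : Qpiece g z p -> Qpiece g (z.1 + 1, z.2) ('X_ord0 * p).
Proof.
rewrite {1}/Qpiece; case: ifP => h; last by move=> ->; rewrite mulr0; exact: Qpiece0.
case=> c ->; have h' : gle g (z.1 + 1, z.2).
  by case/andP: h => h1 h2; rewrite /gle /= h2 andbT (le_trans h1) // lerDl.
rewrite /Qpiece h'; exists c; rewrite -scalerAr -mpolyXD; congr (_ *: 'X_[_]).
rewrite -[in RHS](gdiffE h) -[LHS](gaddK g); congr gdiff.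
by rewrite /gadd !mnmDE !mnm1E /= add0n PoszD [Posz 1 + _]addrC addrA.
Qed.

Lemma Qpiece_X2 g z p :
  Qpiece g z p -> Qpiece g (z.1, z.2 + 1) ('X_ord_max * p).
Proof.
rewrite {1}/Qpiece; case: ifP => h; last by move=> ->; rewrite mulr0; exact: Qpiece0.
case=> c ->; have h' : gle g (z.1, z.2 + 1).
  by case/andP: h => h1 h2; rewrite /gle /= h1 (le_trans h2) // lerDl.
rewrite /Qpiece h'; exists c; rewrite -scalerAr -mpolyXD; congr (_ *: 'X_[_]).
rewrite -[in RHS](gdiffE h) -[LHS](gaddK g); congr gdiff.
by rewrite /gadd !mnmDE !mnm1E /= add0n PoszD [Posz 1 + _]addrC addrA.
Qed.

Section DirectSum.
Variables (I : choiceType) (g : I -> grade).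

Local Notation car := {freeg I / {mpoly K[2]}}.

Definition sumQ_piece (z : grade) (u : car) : Prop :=
  forall i, Qpiece (g i) z (coeff i u).

Fact sumQ_piece0 z : sumQ_piece z 0.
Proof. by move=> i; rewrite coeff0; exact: Qpiece0. Qed.

Fact sumQ_pieceP z (c : K) u v :
  sumQ_piece z u -> sumQ_piece z v -> sumQ_piece z (c%:MP *: u + v).
Proof. by move=> hu hv i; rewrite coeffD coeffZ; exact: QpieceP. Qed.

Fact sumQ_span (v : car) : exists (s : seq grade) (c : grade -> car),
  [/\ uniq s, forall z, sumQ_piece z (c z) & v = \sum_(z <- s) c z].
Proof.
pose c z : car := \sum_(i <- dom v) << Qproj (g i) z (coeff i v) *g i >>.
have cE z i : coeff i (c z) = Qproj (g i) z (coeff i v).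
  rewrite /c raddf_sum /=; case: (boolP (i \in dom v)) => hi.
    rewrite (bigD1_seq i) ?uniq_dom //= coeffU eqxx mulr1 big1 ?addr0 //.
    by move=> j /negbTE nj; rewrite coeffU nj mulr0.
  rewrite (coeff_outdom hi) Qproj0 big1_seq // => j /= hj.
  rewrite coeffU; case: eqP => [e|]; last by rewrite mulr0.
  by rewrite -e hj in hi.
exists (undup (flatten [seq [seq gadd (g i) m | m <- msupp (coeff i v)] | i <- dom v])), c.
split; first exact: undup_uniq.
  by move=> z i; rewrite cE; exact: Qproj_piece.
apply/eqP/freeg_eqP => i; rewrite raddf_sum /=; under eq_bigr do rewrite cE.
apply: Qproj_sum; first exact: undup_uniq.
move=> z hz; rewrite mem_undup; case: (boolP (i \in dom v)) => hi.
  by apply/flatten_mapP; exists i.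
by rewrite (coeff_outdom hi) msupp0 in hz.
Qed.

Fact sumQ_indep (s : seq grade) (c : grade -> car) :
  uniq s -> (forall z, sumQ_piece z (c z)) -> \sum_(z <- s) c z = 0 ->
  forall z, z \in s -> c z = 0.
Proof.
move=> us hc e z zs; apply/eqP/freeg_eqP => i; rewrite coeff0.
have := congr1 (fun u => Qproj (g i) z (coeff i u)) e.
rewrite (bigD1_seq z) //= coeffD QprojD (QprojE (hc z i)) coeff0 Qproj0.
rewrite raddf_sum /= (_ : Qproj _ _ (\sum_(_ <- _ | _) _) = 0) ?addr0 //.
apply: (big_ind (fun p => Qproj (g i) z p = 0)); first exact: Qproj0.
  by move=> p q hp hq; rewrite QprojD hp hq addr0.
by move=> z' nz; exact: Qproj_neq (hc z' i) nz.
Qed.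

Fact sumQ_X1 z u :
  sumQ_piece z u -> sumQ_piece (z.1 + 1, z.2) ('X_ord0 *: u).
Proof. by move=> hu i; rewrite coeffZ; exact: Qpiece_X1. Qed.

Fact sumQ_X2 z u :
  sumQ_piece z u -> sumQ_piece (z.1, z.2 + 1) ('X_ord_max *: u).
Proof. by move=> hu i; rewrite coeffZ; exact: Qpiece_X2. Qed.

(* The direct sum of the Q^(g i), i : I, as finitely supported families. *)
Definition sumQ : bipersModule K :=
  BipersModule sumQ_piece0 sumQ_pieceP sumQ_span sumQ_indep sumQ_X1 sumQ_X2.

End DirectSum.

Definition is_free (M : bipersModule K) : Prop :=
  exists (I : choiceType) (g : I -> grade), bipers_iso M (sumQ g).

End FreeModules.

Section Bases.
Variables (K : fieldType) (M : bipersModule K) (n : nat).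

Definition generates (b : 'I_n -> M) (A : {set 'I_n}) : Prop :=
  forall v : M, exists p : 'I_n -> {mpoly K[2]}, v = \sum_(i in A) p i *: b i.

(* [gr i] is the grade of [b i]; it is passed as data since 0 lies in every
   piece, but minimality excludes b i = 0. Minimality is over sets of indices,
   hence also excludes repetitions. *)
Definition is_basis (gr : 'I_n -> grade) (b : 'I_n -> M) : Prop :=
  [/\ forall i, piece (gr i) (b i),
      generates b setT
    & forall A : {set 'I_n}, generates b A -> A = setT].

Definition is_coord (gr : 'I_n -> grade) (b : 'I_n -> M)
    (z : grade) (v : M) (c : 'cV[K]_n) : Prop :=
  (forall i, ~~ gle (gr i) z -> c i ord0 = 0) /\
  v = \sum_(i | gle (gr i) z) (c i ord0 *: 'X_[gdiff (gr i) z]) *: b i.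

End Bases.

Section Kernel.
Variables (K : fieldType) (M N : bipersModule K) (f : bipersMor M N).

Definition kerpred : {pred M} := fun v => f v == 0.

Fact kerpred_submod : submod_closed kerpred.
Proof.
split=> [|a u v]; rewrite !unfold_in ?raddf0 // => /eqP hu /eqP hv.
by rewrite linearP hu hv scaler0 addr0.
Qed.

HB.instance Definition _ :=
  GRing.isSubmodClosed.Build {mpoly K[2]} M kerpred kerpred_submod.

Definition kercar := {v : M | v \in kerpred}.

HB.instance Definition _ := SubChoice.on kercar.
HB.instance Definition _ := [SubChoice_isSubLmodule of kercar by <:].

Definition ker_piece (z : grade) (u : kercar) : Prop := piece z (val u).

Fact ker_piece0 z : ker_piece z 0.
Proof. exact: piece0. Qed.

Fact ker_pieceP z (c : K) u v :
  ker_piece z u -> ker_piece z v -> ker_piece z (c%:MP *: u + v).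
Proof. exact: pieceP. Qed.

Fact ker_span (v : kercar) : exists (s : seq grade) (c : grade -> kercar),
  [/\ uniq s, forall z, ker_piece z (c z) & v = \sum_(z <- s) c z].
Proof.
have [s [c [us hc e]]] := piece_span (val v).
have fc0 z : z \in s -> f (c z) == 0.
  move=> zs; apply/eqP.
  apply: (piece_indep (c := fun z => f (c z)) us _ _ zs).
    by move=> z'; exact: bmor_piece.
  by rewrite -raddf_sum -e; apply/eqP; exact: (valP v).
exists s, (fun z => insubd (0 : kercar) (c z)); split=> //.
  move=> z; rewrite /ker_piece val_insubd; case: ifP => // _; exact: piece0.
apply/val_inj; rewrite e raddf_sum; apply: eq_big_seq => z zs /=.
by rewrite val_insubd unfold_in fc0.
Qed.

Fact ker_indep (s : seq grade) (c : grade -> kercar) :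
  uniq s -> (forall z, ker_piece z (c z)) -> \sum_(z <- s) c z = 0 ->
  forall z, z \in s -> c z = 0.
Proof.
move=> us hc e z zs; apply/val_inj.
apply: (piece_indep (c := fun z => val (c z)) us hc _ zs).
by rewrite -raddf_sum e.
Qed.

Fact ker_X1 z u : ker_piece z u -> ker_piece (z.1 + 1, z.2) ('X_ord0 *: u).
Proof. exact: piece_X1. Qed.

Fact ker_X2 z u : ker_piece z u -> ker_piece (z.1, z.2 + 1) ('X_ord_max *: u).
Proof. exact: piece_X2. Qed.

Definition bker : bipersModule K :=
  BipersModule ker_piece0 ker_pieceP ker_span ker_indep ker_X1 ker_X2.

Definition bker_incl (u : bker) : M := val (u : kercar).

End Kernel.

Record bigradedMatrix (K : fieldType) (m n : nat) := BigradedMatrix {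
  bgmx :> 'M[K]_(m, n);
  label : 'I_n -> grade;
  label_colex : forall j k : 'I_n, (j <= k)%N -> colex_le (label j) (label k)
}.

Definition mor_matrix (K : fieldType) (F F' : bipersModule K)
    (f : bipersMor F F') (m n : nat)
    (gr : 'I_n -> grade) (B : 'I_n -> F) (gr' : 'I_m -> grade) (B' : 'I_m -> F')
    (A : bigradedMatrix K m n) : Prop :=
  forall j, label A j = gr j /\ is_coord gr' B' (gr j) (f (B j)) (col j A).

Section KerBasis.
Variables (K : fieldType) (m n : nat).

(* [None] stands for null. *)
Definition pivot (R : 'M[K]_(m, n)) (j : 'I_n) : option 'I_m :=
  [pick i | (R i j != 0) && [forall i', (R i' j != 0) ==> (i' <= i)%N]].

Definition add_col (p : nat) (c : K) (k j : 'I_n) (R : 'M[K]_(p, n)) :=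
  \matrix_(i, l) if l == j then R i j + c * R i k else R i l.

Variable A : bigradedMatrix K m n.

Definition reducible (z : grade) (R : 'M[K]_(m, n)) (j k : 'I_n) (p : 'I_m) :=
  [&& (k < j)%N, gle (label A k) z, pivot R j == Some p & pivot R k == Some p].

(* The while loop of step (1), as a big-step relation between the pairs (R, V)
   before and after the loop. The index k is any one satisfying the loop
   condition. *)
Inductive reduce_col (z : grade) (j : 'I_n) :
    'M[K]_(m, n) * 'M[K]_n -> 'M[K]_(m, n) * 'M[K]_n -> Prop :=
| reduce_stop R V :
    (forall k p, ~~ reducible z R j k p) -> reduce_col z j (R, V) (R, V)
| reduce_step R V k p RV' :
    reducible z R j k p ->
    let c := - (R p j / R p k) in
    reduce_col z j (add_col c k j R, add_col c k j V) RV' ->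
    reduce_col z j (R, V) RV'.

Fixpoint for_each (T S : Type) (step : T -> S -> S -> Prop) (l : seq T)
    (s s' : S) : Prop :=
  if l is x :: l' then exists2 t, step x s t & for_each step l' t s'
  else s' = s.

Definition treated (z : grade) : seq 'I_n :=
  [seq j <- enum 'I_n | ((label A j).1 <= z.1) && ((label A j).2 == z.2)].

Record state := State {
  st_R : 'M[K]_(m, n);
  st_V : 'M[K]_n;
  recorded : {set 'I_n};
  output : seq ('cV[K]_n * grade)
}.

Definition init_state := State A 1%:M set0 [::].

Definition newly_zero (z : grade) (R : 'M[K]_(m, n)) (D : {set 'I_n}) :=
  [seq j <- treated z | (col j R == 0) && (j \notin D)].

Definition grade_step (z : grade) (s s' : state) : Prop :=
  for_each (reduce_col z) (treated z) (st_R s, st_V s) (st_R s', st_V s') /\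
  let new := newly_zero z (st_R s') (recorded s) in
  recorded s' = recorded s :|: [set j in new] /\
  output s' = output s ++ [seq (col j (st_V s'), z) | j <- new].

Definition grid : seq grade :=
  sort lex_le (undup [seq (a.1, b.2) | a <- codom (label A), b <- codom (label A)]).

Definition KerBasis (out : seq ('cV[K]_n * grade)) : Prop :=
  exists2 s, for_each grade_step grid init_state s & output s = out.

End KerBasis.

Definition represents_ker_basis (K : fieldType) (F F' : bipersModule K)
    (f : bipersMor F F') (n : nat) (gr : 'I_n -> grade) (B : 'I_n -> F)
    (out : seq ('cV[K]_n * grade)) : Prop :=
  let o i := tnth (in_tuple out) i in
  exists b : 'I_(size out) -> bker f,
    (forall i, is_coord gr B (o i).2 (bker_incl (b i)) (o i).1) /\
    is_basis (fun i => (o i).2) b.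

(* Main.v *)
Require Import Defs.
From HB Require Import structures.
From mathcomp Require Import all_boot all_order all_algebra.
From mathcomp Require Import freeg mpoly.
From mathcomp Require Import zify.

Set Implicit Arguments.
Unset Strict Implicit.
Unset Printing Implicit Defensive.

Import Order.TTheory GRing.Theory Num.Theory.
Local Open Scope ring_scope.

(** The kernel of [gamma] can be computed grade by grade in coordinates. For
    this, a basis in the sense of a minimal homogeneous generating set has to
    give unique coordinates. Freeness of [F] and [F'] enters through the
    following property ([regular]): multiplication by x2 is injective and
    x1 u = x2 v forces u to be a multiple of x2, i.e. x2, x1 is a regular
    sequence ([free_regular]). Over a regular module every minimal finite
    homogeneous generating set is linearly independent ([relation_trivial]),
    hence the module is free ([basis_free]). Regularity passes to kernels of
    morphisms into regular modules ([ker_regular]), so the kernel is free as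
    soon as some finite minimal homogeneous generating set of it is known; the
    output of the algorithm is one.

    With unique coordinates, the elements of the kernel in grade z are the
    vectors c with A c = 0 supported on the columns of label at most z
    ([ker_combo]). The algorithm maintains R = A V with V unitriangular. After
    the visit of z, the columns of R of label at most z that are nonzero have
    distinct pivots, because those with a second coordinate below that of z
    were already reduced against each other at an earlier grade of the same
    first coordinate. Thus c = V d, where d is supported on zero columns of R
    ([reduced_kernel]), and each of these columns was recorded at a grade at
    most z and has not changed since. So the output generates the kernel. It is
    minimal, as even the coordinate vectors in the output are linearly
    independent: they are distinct columns of the invertible matrix V
    ([KerBasis_correct]). *)

(** * Grades and supports *)

Lemma gleP (a b : grade) : reflect (a.1 <= b.1 /\ a.2 <= b.2) (gle a b).
Proof. exact: andP. Qed.

Lemma gle_refl a : gle a a.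
Proof. by rewrite /gle !lexx. Qed.

Lemma gle_trans b a c : gle a b -> gle b c -> gle a c.
Proof.
by move=> /gleP[h1 h2] /gleP[h3 h4]; rewrite /gle (le_trans h1 h3) (le_trans h2).
Qed.

Lemma gdiff_id z : gdiff z z = 0%MM.
Proof. by apply: mnm2P; rewrite ?gdiff0 ?gdiff1 mnm0E subrr. Qed.

Lemma gdiff_trans a b c :
  gle a b -> gle b c -> gdiff a c = (gdiff b c + gdiff a b)%MM.
Proof.
by move=> /gleP[? ?] /gleP[? ?]; apply: mnm2P; rewrite mnmDE ?gdiff0 ?gdiff1; lia.
Qed.

Lemma gdiff_up1 (a b : int) : gdiff (a, b) (a + 1, b) = U_(ord0)%MM.
Proof. by apply: mnm2P; rewrite mnm1E ?gdiff0 ?gdiff1 /=; lia. Qed.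

Lemma gdiff_up2 (a b : int) : gdiff (a, b) (a, b + 1) = U_(ord_max)%MM.
Proof. by apply: mnm2P; rewrite mnm1E ?gdiff0 ?gdiff1 /=; lia. Qed.

Section Below.
Variables (K : fieldType) (n : nat) (gr : 'I_n -> grade).

Definition below (z : grade) (c : 'cV[K]_n) : Prop :=
  forall i, ~~ gle (gr i) z -> c i ord0 = 0.

Lemma belowP z a c d : below z c -> below z d -> below z (a *: c + d).
Proof. by move=> hc hd i hi; rewrite !mxE hc // hd // mulr0 addr0. Qed.

Lemma belowW z z' c : gle z z' -> below z c -> below z' c.
Proof. by move=> h hc i hi; apply: hc; apply: contra hi => /gle_trans; exact. Qed.

End Below.

Lemma mpolyC_eq1 (K : fieldType) (c : K) : c = 1 -> c%:MP_[2] = 1.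
Proof. by move=> ->; exact: rmorph1. Qed.

Lemma mpolyC_eqN1 (K : fieldType) (c : K) : c = -1 -> c%:MP_[2] = -1.
Proof. by move=> ->; rewrite raddfN; congr (- _); exact: mpolyC_eq1. Qed.

(** * Homogeneous elements and their expressions *)

Section Pieces.
Variables (K : fieldType) (M : bipersModule K).

Lemma pieceD z (u v : M) : piece z u -> piece z v -> piece z (u + v).
Proof. by move=> hu hv; have := pieceP 1 hu hv; rewrite mpolyC_eq1 // scale1r. Qed.

Lemma pieceZ z (c : K) (u : M) : piece z u -> piece z (c%:MP *: u).
Proof. by move=> hu; rewrite -[X in piece _ X]addr0; apply: pieceP hu (piece0 _ _). Qed.

Lemma pieceN z (u : M) : piece z u -> piece z (- u).
Proof. by move=> /(pieceZ (-1)); rewrite mpolyC_eqN1 // scaleN1r. Qed.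

Lemma piece_sum z (I : Type) (s : seq I) (P : pred I) (F : I -> M) :
  (forall i, P i -> piece z (F i)) -> piece z (\sum_(i <- s | P i) F i).
Proof. by move=> h; apply: big_ind => //; [exact: piece0|exact: pieceD]. Qed.

Lemma piece_mon z m (v : M) : piece z v -> piece (gadd z m) ('X_[m] *: v).
Proof.
move=> hv.
have h1 k : piece (z.1 + k%:Z, z.2) ('X_ord0 ^+ k *: v).
  elim: k => [|k IH]; first by rewrite addr0 expr0 scale1r; case: (z) hv.
  by rewrite exprS -scalerA (intS k) (addrC 1) addrA; exact: piece_X1 IH.
have h2 k : piece (z.1 + (m ord0)%:Z, z.2 + k%:Z)
    ('X_ord_max ^+ k *: ('X_ord0 ^+ (m ord0) *: v)).
  elim: k => [|k IH]; first by rewrite addr0 expr0 scale1r; exact: h1.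
  by rewrite exprS -scalerA (intS k) (addrC 1) addrA; exact: piece_X2 IH.
suff -> : 'X_[m] = 'X_ord_max ^+ (m ord_max) * 'X_ord0 ^+ (m ord0) :> {mpoly K[2]}.
  by rewrite -scalerA; exact: h2.
rewrite !mpolyXn -mpolyXD; congr 'X_[_].
by apply: mnm2P; rewrite mnmDE !mulmnE !mnm1E /= ?mul0n ?mul1n ?addn0 ?add0n.
Qed.

Lemma piece_term g z (c : K) (v : M) :
  gle g z -> piece g v -> piece z ((c *: 'X_[gdiff g z]) *: v).
Proof.
move=> h hv; rewrite -mul_mpolyC -scalerA; apply: pieceZ.
by rewrite -[X in piece X _](gdiffE h); exact: piece_mon.
Qed.

Lemma piece_Qproj g z (p : {mpoly K[2]}) (v : M) :
  piece g v -> piece z (Qproj g z p *: v).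
Proof.
rewrite /Qproj; case: ifP => [h hv|_ _]; last by rewrite scale0r; exact: piece0.
exact: piece_term.
Qed.

Section Family.
Variables (n : nat) (gr : 'I_n -> grade) (b : 'I_n -> M).
Hypothesis hom_b : forall i, piece (gr i) (b i).

(** The homogeneous element of grade [z] with coordinate vector [c]. *)
Definition combo (z : grade) (c : 'cV[K]_n) : M :=
  \sum_(i | gle (gr i) z) (c i ord0 *: 'X_[gdiff (gr i) z]) *: b i.

Lemma combo_piece z c : piece z (combo z c).
Proof. by apply: piece_sum => i h; exact: piece_term. Qed.

Lemma combo0 z : combo z 0 = 0.
Proof. by rewrite /combo big1 // => i _; rewrite mxE !scale0r. Qed.

Lemma comboP z (a : K) c d :
  combo z (a *: c + d) = a%:MP *: combo z c + combo z d.
Proof.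
rewrite /combo scaler_sumr -big_split; apply: eq_bigr => i _ /=.
by rewrite !mxE scalerDl -scalerA -mul_mpolyC scalerDl -scalerA.
Qed.

Lemma comboD z c d : combo z (c + d) = combo z c + combo z d.
Proof. by have := comboP z 1 c d; rewrite scale1r mpolyC_eq1 // scale1r. Qed.

Lemma comboN z c : combo z (- c) = - combo z c.
Proof.
have := comboP z (-1) c 0.
by rewrite !addr0 scaleN1r combo0 addr0 mpolyC_eqN1 // scaleN1r.
Qed.

Lemma comboZ z (a : K) c : combo z (a *: c) = a%:MP *: combo z c.
Proof. by have := comboP z a c 0; rewrite !addr0 combo0 addr0. Qed.

Lemma combo_sum z (I : Type) (s : seq I) (P : pred I) (F : I -> 'cV[K]_n) :
  combo z (\sum_(i <- s | P i) F i) = \sum_(i <- s | P i) combo z (F i).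
Proof. by apply: (big_morph (combo z)); [exact: comboD|exact: combo0]. Qed.

Lemma combo_shift z z' c : gle z z' -> below gr z c ->
  combo z' c = 'X_[gdiff z z'] *: combo z c.
Proof.
move=> h hc; rewrite /combo scaler_sumr big_mkcond [RHS]big_mkcond.
apply: eq_bigr => i _; case: (boolP (gle (gr i) z)) => hi.
  rewrite (gle_trans hi h) (gdiff_trans hi h) mpolyXD.
  by rewrite [in RHS]scalerA scalerAr.
by rewrite (hc _ hi) !scale0r if_same.
Qed.

Lemma combo_sum_all z (p : 'I_n -> {mpoly K[2]}) :
  \sum_i Qproj (gr i) z (p i) *: b i
  = combo z (\col_i if gle (gr i) z then (p i)@_(gdiff (gr i) z) else 0).
Proof.
rewrite /combo [RHS]big_mkcond; apply: eq_bigr => i _.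
by rewrite mxE /Qproj; case: ifP => // _; rewrite scale0r.
Qed.

(** The graded components of a polynomial combination are computed termwise.
    The list [s0] allows a given grade to be included even if the component
    there is zero. *)
Lemma components (p : 'I_n -> {mpoly K[2]}) (s0 : seq grade) :
  exists s, [/\ uniq s, {subset s0 <= s},
    forall i, p i = \sum_(z <- s) Qproj (gr i) z (p i) &
    \sum_i p i *: b i = \sum_(z <- s) \sum_i Qproj (gr i) z (p i) *: b i].
Proof.
pose t := flatten [seq [seq gadd (gr i) m | m <- msupp (p i)] | i <- enum 'I_n].
exists (undup (s0 ++ t)).
have pE i : p i = \sum_(z <- undup (s0 ++ t)) Qproj (gr i) z (p i).
  apply: Qproj_sum; first exact: undup_uniq.
  move=> z hz; rewrite mem_undup mem_cat; apply/orP; right.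
  by apply/flatten_mapP; exists i => //; rewrite mem_enum.
split => //; first exact: undup_uniq.
  by move=> z hz; rewrite mem_undup mem_cat hz.
rewrite exchange_big; apply: eq_bigr => i _ /=.
by rewrite {1}[p i]pE scaler_suml.
Qed.

(** In a grading, the homogeneous element [v] is its own component of degree
    [z], so homogeneous elements have homogeneous expressions. *)
Lemma hom_component z v (p : 'I_n -> {mpoly K[2]}) :
  piece z v -> v = \sum_i p i *: b i ->
  v = \sum_i Qproj (gr i) z (p i) *: b i.
Proof.
move=> hv ev; have [s [us /(_ z) zs _ es]] := components p [:: z].
rewrite es in ev; have {}zs := zs (mem_head _ _).
pose w z' := (\sum_i Qproj (gr i) z' (p i) *: b i) - (if z' == z then v else 0).
apply/eqP; rewrite eq_sym -subr_eq0; apply/eqP.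
have := @piece_indep _ M s w us _ _ z zs; rewrite /w eqxx; apply.
  move=> z'; apply: pieceD; first by apply: piece_sum => i _; exact: piece_Qproj.
  by case: eqP => [->|_]; apply: pieceN => //; exact: piece0.
rewrite sumrB -ev (bigD1_seq z) //= eqxx big1 ?addr0 ?subrr //.
by move=> z' /negbTE ->.
Qed.

Lemma hom_generates (A : {set 'I_n}) z v : generates b A -> piece z v ->
  exists c, [/\ below gr z c, forall i, i \notin A -> c i ord0 = 0 & v = combo z c].
Proof.
move=> gen hv; have [p ev] := gen v.
pose q i := if i \in A then p i else 0.
have eq : v = \sum_i q i *: b i.
  rewrite {1}ev big_mkcond; apply: eq_bigr => i _; rewrite /q.
  by case: ifP => //; rewrite scale0r.
exists (\col_i if gle (gr i) z then (q i)@_(gdiff (gr i) z) else 0); split.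
- by move=> i /negbTE hi; rewrite mxE hi.
- by move=> i /negbTE hi; rewrite mxE /q hi mcoeff0 if_same.
- by rewrite -combo_sum_all; exact: hom_component.
Qed.

End Family.
End Pieces.

(** * Regularity *)

(** x2, x1 is a regular sequence on [M]: x2 is injective on [M], and x1 is
    injective on M/x2M. Only homogeneous elements are tested, which spares
    working with the graded components of a general element. *)
Record regular (K : fieldType) (M : bipersModule K) : Prop := Regular {
  regular_inj : forall z (u : M), piece z u -> 'X_ord_max *: u = 0 -> u = 0;
  regular_quot : forall (a b : int) (u v : M),
    piece (a, b + 1) u -> piece (a + 1, b) v ->
    'X_ord0 *: u = 'X_ord_max *: v ->
    exists2 w, piece (a, b) w & u = 'X_ord_max *: w
}.

Section RegularFree.
Variable K : fieldType.

Lemma mulX_eq0 i (p : {mpoly K[2]}) : 'X_i * p = 0 -> p = 0.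
Proof.
move/eqP; rewrite mulf_eq0 => /orP[|/eqP //] /eqP/(congr1 (mcoeff U_(i))).
by rewrite mcoeffX eqxx mcoeff0 => /eqP; rewrite oner_eq0.
Qed.

Lemma Qpiece_quot g (a b : int) (p q : {mpoly K[2]}) :
  Qpiece g (a, b + 1) p -> Qpiece g (a + 1, b) q ->
  'X_ord0 * p = 'X_ord_max * q ->
  p = 'X_ord_max * (if gle g (a, b) then
        p@_(gdiff g (a, b + 1)) *: 'X_[gdiff g (a, b)] else 0).
Proof.
move=> hp hq e; case: (boolP (gle g (a, b))) => h.
  have h1 : gle (a, b) (a, b + 1) by rewrite /gle /= lexx lerDl.
  rewrite -{1}(QprojE hp) /Qproj (gle_trans h h1) -scalerAr -mpolyXD.
  by rewrite (gdiff_trans h h1) gdiff_up2.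
rewrite mulr0; move: hp; rewrite /Qpiece; case: ifP => // h1 hp.
have q0 : q = 0.
  move: hq; rewrite /Qpiece ifN //; move: h h1; rewrite /gle /=.
  by move=> h /andP[h1 h2]; apply: contra h => /andP[_ ->]; rewrite h1.
by rewrite q0 mulr0 in e; exact: mulX_eq0 e.
Qed.

Lemma sumQ_regular (I : choiceType) (g : I -> grade) : regular (sumQ K g).
Proof.
split=> [z u _ e|a b u v hu hv e].
  apply/eqP/freeg_eqP => i; rewrite coeff0; apply: (@mulX_eq0 ord_max).
  by rewrite -coeffZ e coeff0.
pose r i : {mpoly K[2]} := if gle (g i) (a, b) then
  (coeff i u)@_(gdiff (g i) (a, b + 1)) *: 'X_[gdiff (g i) (a, b)] else 0.
pose w : {freeg I / {mpoly K[2]}} := \sum_(i <- dom u) << r i *g i >>.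
have wE i : coeff i w = r i.
  rewrite /w raddf_sum /=; case: (boolP (i \in dom u)) => hi.
    rewrite (bigD1_seq i) ?uniq_dom //= coeffU eqxx mulr1 big1 ?addr0 //.
    by move=> j /negbTE nj; rewrite coeffU nj mulr0.
  rewrite /r (coeff_outdom hi) mcoeff0 scale0r if_same big1_seq // => j /= hj.
  rewrite coeffU; case: eqP => [ej|]; last by rewrite mulr0.
  by rewrite -ej hj in hi.
exists w.
  rewrite /= => i; rewrite wE /r /Qpiece; case: (gle _ _) => //.
  by exists ((coeff i u)@_(gdiff (g i) (a, b + 1))).
apply/eqP/freeg_eqP => i; rewrite coeffZ wE.
by apply: Qpiece_quot (hu i) (hv i) _; rewrite -!coeffZ e.
Qed.

Lemma iso_regular (M N : bipersModule K) :
  bipers_iso M N -> regular N -> regular M.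
Proof.
move=> [f [g [fK gK]]] [inj quo].
have f0 u : f u = 0 -> u = 0 by move=> e; rewrite -(fK u) e raddf0.
split=> [z u hu e|a b u v hu hv e].
  by apply/f0/inj; [exact: (bmor_piece f hu)|rewrite -linearZ e raddf0].
have [|w hw ew] := quo a b (f u) (f v) (bmor_piece f hu) (bmor_piece f hv).
  by rewrite -!linearZ e.
exists (g w); first exact: bmor_piece.
by rewrite -(fK u) ew linearZ.
Qed.

Lemma free_regular (M : bipersModule K) : is_free M -> regular M.
Proof. by move=> [I [g iso]]; apply: iso_regular iso (sumQ_regular g). Qed.

(** If u = x2 w with u in the kernel, then x2 annihilates the image of w, so w
    is in the kernel as well. *)
Lemma ker_regular (M N : bipersModule K) (f : bipersMor M N) :
  regular M -> regular N -> regular (bker f).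
Proof.
move=> [inj quo] [inj' _].
split=> [z u hu e|a b u v hu hv e].
  by apply/val_inj/(inj z) => //; exact: (congr1 val e).
have [|w hw ew] := quo a b (val u) (val v) hu hv; first exact: (congr1 val e).
have fw : w \in kerpred f.
  rewrite unfold_in; apply/eqP/(inj' (a, b)); first exact: bmor_piece.
  by rewrite -linearZ -ew; apply/eqP; exact: (valP u).
by exists (Sub w fw); [exact: hw|apply: val_inj].
Qed.

End RegularFree.

(** * Bases of regular modules *)

Section RegularBasis.
Variables (K : fieldType) (M : bipersModule K).
Variables (n : nat) (gr : 'I_n -> grade) (b : 'I_n -> M).
Hypothesis regM : regular M.
Hypothesis basis_b : is_basis gr b.

Let hom_b i : piece (gr i) (b i). Proof. by case: basis_b. Qed.

Lemma basis_irredundant i (q : 'I_n -> {mpoly K[2]}) :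
  b i = \sum_(k | k != i) q k *: b k -> False.
Proof.
case: basis_b => _ gen mini ebi.
suff /mini/setP/(_ i) : generates b [set~ i] by rewrite !inE eqxx.
move=> v; have [p ->] := gen v.
exists (fun k => p k + p i * q k).
rewrite (bigD1 i) ?inE //= {1}ebi scaler_sumr.
rewrite [X in _ + X](eq_bigl (fun k => k != i)); last by move=> k; rewrite inE.
rewrite [RHS](eq_bigl (fun k => k != i)); last by move=> k; rewrite !inE.
rewrite -big_split; apply: eq_bigr => k _ /=.
by rewrite scalerDl scalerA addrC.
Qed.

(** A generator of grade [z] occurs in a relation of grade [z] with a constant
    coefficient, and could be expressed by the others if this were nonzero. *)
Lemma relation_top z c i : combo gr b z c = 0 -> gr i = z -> c i ord0 = 0.
Proof.
move=> e ez; apply/eqP/negPn/negP => ci.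
pose q k := if gle (gr k) z then
  - (c i ord0)^-1 *: (c k ord0 *: 'X_[gdiff (gr k) z]) else 0 : {mpoly K[2]}.
apply: (@basis_irredundant i q).
move: e; rewrite /combo (bigD1 i) /=; last by rewrite ez gle_refl.
rewrite ez gdiff_id mpolyX0 => /eqP; rewrite addr_eq0 => /eqP e.
have : ((c i ord0)^-1)%:MP *: ((c i ord0 *: 1) *: b i) = b i.
  rewrite scalerA mul_mpolyC scalerA mulVf //.
  by rewrite !scale1r.
move=> <-; rewrite e scalerN scaler_sumr -sumrN big_mkcond [RHS]big_mkcond.
apply: eq_bigr => k _; rewrite /q.
case: (k != i); rewrite ?andbT ?andbF //; case: (gle _ z); last by rewrite scale0r.
by rewrite scalerA mul_mpolyC scaleNr scaleNr.
Qed.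

(** Uniqueness of coordinates, by induction on the total degree of the grade.
    A relation of grade [z] cannot involve generators of grade [z], so it has
    the form [x1 u + x2 v = 0] with [u] and [v] given by complementary parts of
    its coefficients. Regularity gives [w] with [u = x2 w] and [v = - x1 w];
    expanding [w] in the generators turns both equations into relations of
    smaller degree. By induction the coefficients of [u] are those of [w] and
    the coefficients of [v] their opposites, so that their sum vanishes. *)
Lemma relation_trivial z c : below gr z c -> combo gr b z c = 0 -> c = 0.
Proof.
have [N hN] : exists N : nat, forall i,
    z.1 + z.2 < (gr i).1 + (gr i).2 + N%:Z.
  (* Large enough that no generator has total degree z.1 + z.2 - N or less. *)
  exists (\max_i absz (z.1 + z.2 - ((gr i).1 + (gr i).2))%R).+1 => i.
  have := leq_bigmax (F := fun i => absz (z.1 + z.2 - ((gr i).1 + (gr i).2))%R) i.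
  by move=> /= h; lia.
elim: N z c hN => [|N IH] [z1 z2] c /= hN hc e.
  apply/colP => i; rewrite mxE; apply: hc; apply/negP => /gleP /= [h1 h2].
  by have := hN i; lia.
pose za : grade := (z1 - 1, z2); pose zb : grade := (z1, z2 - 1).
pose zab : grade := (z1 - 1, z2 - 1).
have ea : z1 = (z1 - 1) + 1 by rewrite subrK.
have eb : z2 = (z2 - 1) + 1 by rewrite subrK.
have da : gdiff za (z1, z2) = U_(ord0)%MM by rewrite {1}ea gdiff_up1.
have db : gdiff zb (z1, z2) = U_(ord_max)%MM by rewrite {1}eb gdiff_up2.
have dab : gdiff zab za = U_(ord_max)%MM by rewrite /za {1}eb gdiff_up2.
have dba : gdiff zab zb = U_(ord0)%MM by rewrite /zb {1}ea gdiff_up1.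
have la : gle za (z1, z2) by rewrite /gle /= lexx andbT gerDl.
have lb : gle zb (z1, z2) by rewrite /gle /= lexx gerDl.
have lab : gle zab za by rewrite /gle /= lexx gerDl.
have lba : gle zab zb by rewrite /gle /= lexx andbT gerDl.
(* [u] collects the generators of grade at most z - e1; the remaining ones
   are at most z - e2, as none of them has grade z. *)
pose ca := \col_i (if gle (gr i) za then c i ord0 else 0).
pose cb := c - ca.
have hca : below gr za ca by move=> i /negbTE hi; rewrite mxE hi.
have hcb : below gr zb cb.
  move=> i hi; rewrite !mxE; case: (boolP (gle (gr i) za)) => ha.
    by rewrite subrr.
  rewrite subr0; case: (boolP (gle (gr i) (z1, z2))) => h; last exact: hc.
  apply: relation_top e _; move: hi ha h; rewrite /gle /=.
  by case: (gr i) => x y /= h1 h2 h3; congr (_, _); lia.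
have ec : c = ca + cb by rewrite addrC subrK.
have e12 : 'X_ord0 *: combo gr b za ca = 'X_ord_max *: (- combo gr b zb cb).
  apply/eqP; rewrite scalerN -addr_eq0 -da -db -!combo_shift //.
  by rewrite -comboD -ec e.
have [||w hw ew] := regular_quot regM (a := z1 - 1) (b := z2 - 1) _ _ e12.
- by rewrite -eb; exact: combo_piece.
- by rewrite -ea; apply: pieceN; exact: combo_piece.
have gen : generates b setT by case: basis_b.
have [d [hd _ ewd]] := hom_generates hom_b gen hw.
have eqa : ca - d = 0.
  apply: (IH za) => [i| |] /=; first by have := hN i; lia.
    rewrite -[ca - d]addrC -scaleN1r; apply: belowP => //; exact: belowW hd.
  by rewrite comboD comboN (combo_shift _ lab hd) dab -ewd ew subrr.
have eqb : cb + d = 0.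
  apply: (IH zb) => [i| |] /=; first by have := hN i; lia.
    rewrite -[cb]scale1r; apply: belowP => //; exact: belowW hd.
  rewrite comboD (combo_shift _ lba hd) dba -ewd.
  have h2 : piece zb (combo gr b zb cb + 'X_ord0 *: w).
    apply: pieceD; first exact: combo_piece.
    by have := piece_mon (gdiff zab zb) hw; rewrite gdiffE // dba.
  apply: (regular_inj regM h2); rewrite scalerDr -[X in X + _]opprK -scalerN -e12 ew.
  by rewrite !scalerA [in X in - X + _]mulrC addNr.
by rewrite ec -[ca](subrK d) eqa add0r addrC.
Qed.

Lemma coord_inj z c d : below gr z c -> below gr z d ->
  combo gr b z c = combo gr b z d -> c = d.
Proof.
move=> hc hd e; apply/eqP; rewrite -subr_eq0; apply/eqP.
apply: (@relation_trivial z); last by rewrite comboD comboN e subrr.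
by rewrite addrC -scaleN1r; exact: belowP.
Qed.

Lemma lin_indep (p : 'I_n -> {mpoly K[2]}) :
  \sum_i p i *: b i = 0 -> forall i, p i = 0.
Proof.
move=> e i; have [s [us _ /(_ i) -> es]] := components gr b p [::].
rewrite big1_seq // => z /= zs.
have {es} hz : \sum_i Qproj (gr i) z (p i) *: b i = 0.
  rewrite es in e.
  apply: (piece_indep (c := fun z => \sum_i Qproj (gr i) z (p i) *: b i) us _ e zs).
  by move=> z'; apply: piece_sum => j _; exact: piece_Qproj.
rewrite combo_sum_all in hz.
have h0 := relation_trivial _ hz.
have {h0} h0 : (\col_j if gle (gr j) z then (p j)@_(gdiff (gr j) z) else 0) = 0.
  by apply: h0 => j /negbTE hj; rewrite mxE hj.
have := congr1 (fun c : 'cV[K]_n => c i ord0) h0.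
rewrite !mxE /Qproj; case: ifP => // _ ->; by rewrite scale0r.
Qed.

Theorem basis_free : is_free M.
Proof.
have gen (v : M) : exists p : {ffun 'I_n -> {mpoly K[2]}}, v == \sum_i p i *: b i.
  case: basis_b => _ /(_ v)[p ->] _; exists [ffun i => p i]; apply/eqP.
  by apply: eq_big => [i|i _]; rewrite ?inE ?ffunE.
(* Coordinates are unique, so choosing some of them gives a linear map. *)
pose crd v := xchoose (gen v).
have crdE v : v = \sum_i crd v i *: b i by apply/eqP/(xchooseP (gen v)).
have crdU v (p : 'I_n -> {mpoly K[2]}) : v = \sum_i p i *: b i -> forall i, crd v i = p i.
  move=> e i; apply/eqP; rewrite -subr_eq0; apply/eqP.
  apply: (lin_indep (p := fun i => crd v i - p i)) => //.
  under eq_bigr do rewrite scalerBl.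
  by rewrite sumrB -crdE -e subrr.
pose f (u : sumQ K gr) : M := \sum_i coeff i u *: b i.
pose g (v : M) : sumQ K gr := \sum_i << crd v i *g i >>.
have gE v i : coeff i (g v) = crd v i.
  rewrite /g raddf_sum (bigD1 i) //= coeffU eqxx mulr1 big1 ?addr0 //.
  by move=> j /negbTE nj; rewrite coeffU nj mulr0.
have lin_f : linear f.
  move=> a u v; rewrite /f scaler_sumr -big_split; apply: eq_bigr => i _ /=.
  by rewrite coeffD coeffZ scalerDl scalerA.
have lin_g : linear g.
  move=> a u v; apply/eqP/freeg_eqP => i; rewrite coeffD coeffZ !gE.
  rewrite (crdU (a *: u + v) (fun i => a * crd u i + crd v i)) //.
  under eq_bigr do rewrite scalerDl -scalerA.
  by rewrite big_split -scaler_sumr -!crdE.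
have fK : cancel f g.
  by move=> u; apply/eqP/freeg_eqP => i; rewrite gE; exact: (crdU (f u) (fun i => coeff i u)).
have gK : cancel g f.
  by move=> v; rewrite /f; under eq_bigr do rewrite gE; rewrite -crdE.
pose fA := GRing.isLinear.Build _ _ _ _ f lin_f.
pose gA := GRing.isLinear.Build _ _ _ _ g lin_g.
pose fL : {linear _ -> _} := HB.pack f fA.
pose gL : {linear _ -> _} := HB.pack g gA.
exists 'I_n, gr.
have fP z u : piece z u -> piece z (fL u).
  move=> /= hu; apply: piece_sum => i _; rewrite -(QprojE (hu i)).
  exact: piece_Qproj.
have gP z v : piece z v -> piece z (gL v).
  move=> hv /= i; rewrite gE (crdU v (fun i => Qproj (gr i) z (crd v i))).
    exact: Qproj_piece.
  exact: hom_component.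
by exists (BipersMor gP), (BipersMor fP).
Qed.

End RegularBasis.

(** * Column reduction *)

Section Reduction.
Variables (K : fieldType) (m n : nat) (A : bigradedMatrix K m n).
Implicit Types (R : 'M[K]_(m, n)) (V : 'M[K]_n) (S : 'M[K]_(m, n) * 'M[K]_n).

Lemma mulmx_sum_col p (V : 'M[K]_(p, n)) (d : 'cV[K]_n) :
  V *m d = \sum_j d j ord0 *: col j V.
Proof.
apply/colP => i; rewrite !mxE summxE; apply: eq_bigr => j _.
by rewrite !mxE mulrC.
Qed.

Lemma colE_eq p (R R' : 'M[K]_(p, n)) j :
  col j R = col j R' -> forall i, R i j = R' i j.
Proof. by move=> /colP e i; have := e i; rewrite !mxE. Qed.

Lemma pivotP R j p :
  reflect (R p j != 0 /\ forall i, R i j != 0 -> (i <= p)%N)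
          (pivot R j == Some p).
Proof.
rewrite /pivot; case: pickP => [q /andP[q0 /forallP qm]|none].
  apply: (iffP eqP) => [[<-]|[p0 pm]].
    by split=> // i; apply/implyP.
  congr Some; apply/val_inj/eqP; rewrite /= eqn_leq pm //.
  by have /implyP := qm p; apply.
apply: (iffP eqP) => // -[p0 pm]; have := none p.
by rewrite p0 => /negP[]; apply/forallP => i; apply/implyP; exact: pm.
Qed.

Lemma pivot_ext R R' j : col j R = col j R' -> pivot R j = pivot R' j.
Proof.
move=> /colE_eq e; apply: eq_pick => i /=; rewrite e; congr (_ && _).
by apply: eq_forallb => i'; rewrite e.
Qed.

Lemma pivot_zero R j : col j R = 0 -> pivot R j = None.
Proof.
move=> e; case ep: (pivot R j) => [p|] //; move/eqP/pivotP: ep => [+ _].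
by have /colP/(_ p) := e; rewrite !mxE => ->; rewrite eqxx.
Qed.

Lemma pivot_nonzero R j : col j R != 0 -> exists p, pivot R j == Some p.
Proof.
move=> h; have [i0 hi0] : exists i, R i j != 0.
  apply/existsP; apply: contraR h; rewrite negb_exists => /forallP h.
  by apply/eqP/colP => i; rewrite !mxE; apply/eqP/negPn.
pose P (i : 'I_m) := R i j != 0; have Pi0 : P i0 := hi0.
case: (arg_maxnP (fun i : 'I_m => i : nat) Pi0) => p p0 pm.
by exists p; apply/pivotP.
Qed.

Lemma col_add_col p c k j l (R : 'M[K]_(p, n)) :
  l != j -> col l (add_col c k j R) = col l R.
Proof. by move=> /negbTE h; apply/colP => i; rewrite !mxE h. Qed.

Lemma mul_add_col c k j V : A *m add_col c k j V = add_col c k j (A *m V).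
Proof.
apply/matrixP => i l; rewrite !mxE; case: eqP => [->|/eqP/negbTE h].
  rewrite mulr_sumr -big_split; apply: eq_bigr => q _ /=.
  by rewrite !mxE eqxx mulrDr mulrCA.
by apply: eq_bigr => q _; rewrite mxE h.
Qed.

Lemma reducible_ext z R R' (j k : 'I_n) p :
  ((k < j)%N -> col j R = col j R' /\ col k R = col k R') ->
  reducible A z R j k p = reducible A z R' j k p.
Proof.
rewrite /reducible; case: ltnP => // _ [] // ej ek.
by rewrite (pivot_ext ej) (pivot_ext ek).
Qed.

(** Every step of the while loop lowers the pivot of column [j]. *)
Lemma reduce_col_total z j S : exists S', reduce_col A z j S S'.
Proof.
case: S => R V.
have [N hN] : exists N, forall i : 'I_m, (N <= i)%N -> R i j = 0.
  by exists m => i; rewrite leqNgt ltn_ord.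
elim: N R V hN => [|N IH] R V hN;
  (case: (boolP [exists k, exists p, reducible A z R j k p]) => [|none]; last first;
    [by exists (R, V); apply: reduce_stop => k p; apply: contra none => h;
      apply/existsP; exists k; apply/existsP; exists p|];
   case/existsP => k /existsP[p red]; have /and4P[kj _ /pivotP[pj hj] /pivotP[pk hk]] := red).
  by rewrite hN ?eqxx in pj.
have pN : (p <= N)%N by rewrite leqNgt; apply: contra pj => h; rewrite hN.
have [|S' hS'] := IH (add_col (- (R p j / R p k)) k j R)
                     (add_col (- (R p j / R p k)) k j V).
  move=> i hi; rewrite mxE eqxx.
  have [ei|ne] := eqVneq i p; first by rewrite ei mulNr divfK ?subrr.
  have ip : (p < i)%N by rewrite ltn_neqAle eq_sym ne (leq_trans pN).
  have -> : R i j = 0 by apply/eqP; apply: contraTT ip => /hj; rewrite -leqNgt.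
  have -> : R i k = 0 by apply/eqP; apply: contraTT ip => /hk; rewrite -leqNgt.
  by rewrite mulr0 addr0.
by exists S'; exact: reduce_step red hS'.
Qed.

Lemma reduce_col_frame z j S S' : reduce_col A z j S S' ->
  forall l, l != j -> col l S'.1 = col l S.1 /\ col l S'.2 = col l S.2.
Proof.
elim=> // R V k p RV' _ c _ IH l lj; have [/= -> ->] := IH l lj.
by rewrite !col_add_col.
Qed.

Lemma reduce_col_zero z j S S' :
  reduce_col A z j S S' -> col j S.1 = 0 -> S' = S.
Proof.
case=> // R V k p RV' /and4P[_ _ hj _] c _ /= /pivot_zero e.
by rewrite e in hj.
Qed.

Lemma reduce_col_irreducible z j S S' : reduce_col A z j S S' ->
  forall k p, ~~ reducible A z S'.1 j k p.
Proof. by elim. Qed.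

(** [V] records the operations performed so far. Its column [j] only involves
    columns of index at most [j], hence of second coordinate at most that of
    [j]; the bound [x] on the first coordinate of the grades visited so far
    controls the other coordinate. *)
Record tracking (x : int) S : Prop := Tracking {
  track_mul : S.1 = A *m S.2;
  track_diag : forall j, S.2 j j = 1;
  track_upper : forall i j : 'I_n, S.2 i j != 0 -> (i <= j)%N;
  track_label : forall i j, S.2 i j != 0 ->
    (label A i).1 <= Num.max x (label A j).1
}.

Lemma tracking_step z j S S' : reduce_col A z j S S' ->
  (label A j).1 <= z.1 -> tracking z.1 S -> tracking z.1 S'.
Proof.
elim=> // R V k p RV' /and4P[kj /gleP[kz _] _ _] c _ IH jz [/= eR d u lb].
apply: IH => //; split=> /= [|l|i l|i l].
- by rewrite mul_add_col -eR.
- rewrite mxE; case: (l =P j) => [->|_]; last exact: d.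
  rewrite d (_ : V j k = 0) ?mulr0 ?addr0 //; apply/eqP.
  by apply: contraTT kj => /u; rewrite -leqNgt.
- rewrite mxE; case: (l =P j) => [->|_]; last exact: u.
  have [->|/u //] := eqVneq (V i j) 0; rewrite add0r mulf_eq0 negb_or => /andP[_].
  by move=> /u /leq_trans; apply; exact: ltnW.
rewrite mxE; case: (l =P j) => [->|_]; last exact: lb.
have [->|/lb //] := eqVneq (V i j) 0; rewrite add0r mulf_eq0 negb_or => /andP[_].
by move=> /lb /le_trans; apply; rewrite ge_max !le_max lexx kz.
Qed.

Lemma trackingW x y S : x <= y -> tracking x S -> tracking y S.
Proof.
move=> xy [e d u lb]; split=> // i j /lb /le_trans; apply.
by rewrite ge_max !le_max xy lexx orbT.
Qed.

Lemma tracking_below z S j : tracking z.1 S -> gle (label A j) z ->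
  below (label A) z (col j S.2).
Proof.
move=> [_ _ u lb] /gleP[j1 j2] i; rewrite mxE => h.
apply/eqP; apply: contraNT h => nz; apply/gleP; split.
  by apply: le_trans (lb _ _ nz) _; rewrite ge_max lexx.
apply: le_trans _ j2; have := label_colex A (u _ _ nz); rewrite /colex_le.
by case/orP => [/ltW|/andP[/eqP -> _]].
Qed.

Lemma tracking_unit x S : tracking x S -> S.2 \in unitmx.
Proof.
move=> [_ d u _]; rewrite -unitmx_tr unitmxE det_trig.
  by rewrite big1 ?unitr1 // => i _; rewrite mxE d.
apply/is_trig_mxP => i j ij; rewrite mxE; apply/eqP.
by apply: contraTT ij => /u; rewrite -leqNgt.
Qed.

Lemma pass_frame z l S S' : for_each (reduce_col A z) l S S' ->
  forall k, k \notin l -> col k S'.1 = col k S.1 /\ col k S'.2 = col k S.2.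
Proof.
elim: l S => [|x l IH] S /= => [-> //|[T hT hS] k].
rewrite inE negb_or => /andP[kx kl]; have [-> ->] := IH _ hS k kl.
exact: reduce_col_frame hT k kx.
Qed.

Lemma pass_zero z l S S' : for_each (reduce_col A z) l S S' ->
  forall k, col k S.1 = 0 -> col k S'.1 = col k S.1 /\ col k S'.2 = col k S.2.
Proof.
elim: l S => [|x l IH] S /= => [-> //|[T hT hS] k k0].
have [eT1 eT2] : col k T.1 = col k S.1 /\ col k T.2 = col k S.2.
  have [e|] := eqVneq k x; last exact: reduce_col_frame hT k.
  by rewrite (reduce_col_zero hT) // -e.
by have [|-> ->] := IH _ hS k; rewrite eT1.
Qed.

(** Being reduced only concerns a column and its predecessors, and the columns
    treated later in the pass come after it. *)
Lemma pass_irreducible z (l : seq 'I_n) S S' :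
  sorted (fun i j : 'I_n => (i < j)%N) l -> for_each (reduce_col A z) l S S' ->
  forall j, j \in l -> forall k p, ~~ reducible A z S'.1 j k p.
Proof.
elim: l S => [//|x l IH] S /= hp [T hT hS] j.
have ltl y : y \in l -> (x < y)%N.
  by move=> hy; apply: (allP (order_path_min _ hp)) => // ? ? ?; exact: ltn_trans.
rewrite inE => /predU1P[->|jl]; last exact: IH (path_sorted hp) hS j jl.
move=> k p; rewrite (@reducible_ext _ _ T.1); first exact: reduce_col_irreducible hT k p.
move=> kx; split; apply: (pass_frame hS _).1.
  by apply/negP => /ltl; rewrite ltnn.
by apply/negP => /ltl /(ltn_trans kx); rewrite ltnn.
Qed.

Lemma pass_tracking z l S S' : for_each (reduce_col A z) l S S' ->
  {in l, forall j, (label A j).1 <= z.1} -> tracking z.1 S -> tracking z.1 S'.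
Proof.
elim: l S => [|x l IH] S /= => [-> //|[T hT hS] hl tS].
apply: IH hS _ _ => [j jl|]; first by apply: hl; rewrite inE jl orbT.
by apply: tracking_step hT _ tS; apply: hl; rewrite inE eqxx.
Qed.

Lemma mem_treated z j :
  (j \in treated A z) = ((label A j).1 <= z.1) && ((label A j).2 == z.2).
Proof. by rewrite mem_filter mem_enum andbT. Qed.

Lemma treated_sorted z : sorted (fun i j : 'I_n => (i < j)%N) (treated A z).
Proof.
apply: sorted_filter; first by move=> ? ? ?; exact: ltn_trans.
have := iota_ltn_sorted 0 n; rewrite -val_enum_ord sorted_map.
by [].
Qed.

Lemma treated_uniq z : uniq (treated A z).
Proof. by rewrite filter_uniq // enum_uniq. Qed.

(** The columns of [V] of label at most [z] form a unitriangular matrix on the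
    indices of label at most [z]; the induction is back substitution. *)
Lemma tracking_solve (z : grade) S c : tracking z.1 S -> below (label A) z c ->
  exists2 d, c = S.2 *m d & below (label A) z d.
Proof.
move=> tS hc; have [N hN] : exists N, forall i : 'I_n, (N <= i)%N -> c i ord0 = 0.
  by exists n => i; rewrite leqNgt ltn_ord.
elim: N c hc hN => [|N IH] c hc hN.
  by exists 0; [apply/colP => i; rewrite mulmx0 mxE hN | move=> i _; rewrite mxE].
have [nN|Nn] := leqP n N; first by apply: IH => // i /(leq_trans nN); rewrite leqNgt ltn_ord.
pose k := Ordinal Nn.
have [kz|kz] := boolP (gle (label A k) z); last first.
  apply: IH => // i; rewrite leq_eqVlt => /predU1P[e|]; last exact: hN.
  by apply: hc; rewrite (_ : i = k) //; apply/val_inj.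
have hk := tracking_below tS kz.
have [|d ed hd] := IH _ (belowP (- c k ord0) hk hc); last first.
  exists (c k ord0 *: delta_mx k ord0 + d).
    by rewrite mulmxDr -scalemxAr -colE -ed addrA scaleNr subrr add0r.
  apply: belowP => // i; rewrite mxE andbT => hi; case: eqP => // e.
  by rewrite e kz in hi.
move=> i; rewrite !mxE leq_eqVlt => /predU1P[e|h].
  by rewrite (_ : i = k) ?(track_diag tS) ?mulr1 ?addNr //; apply/val_inj.
rewrite (hN i h) addr0 (_ : S.2 i k = 0) ?mulr0 //; apply/eqP.
by apply: contraTT h => /(track_upper tS); rewrite -leqNgt.
Qed.

(** Nonzero columns with distinct pivots are linearly independent: in a linear
    combination the largest pivot involved cannot cancel. Hence, once the
    columns of label at most [z] are reduced, the kernel vectors supported on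
    them are the combinations of the columns of [V] at the zero columns. *)
Lemma reduced_kernel z S c : tracking z.1 S ->
  (forall j k p, gle (label A j) z -> gle (label A k) z -> (k < j)%N ->
     ~~ ((pivot S.1 j == Some p) && (pivot S.1 k == Some p))) ->
  below (label A) z c -> A *m c = 0 ->
  exists2 d, c = S.2 *m d &
    forall j, d j ord0 != 0 -> gle (label A j) z /\ col j S.1 = 0.
Proof.
move=> tS irr hc Ac; have [d ed hd] := tracking_solve tS hc.
have dz j : d j ord0 != 0 -> gle (label A j) z.
  by move=> nz; apply/negPn; apply: contra nz => /hd ->.
exists d => // j dj; split; first exact: dz.
apply/eqP/negPn/negP => cj.
pose P l := (d l ord0 != 0) && (col l S.1 != 0).
(* [pv] only matters on nonzero columns; zero columns get a dummy value. *)
pose pv l := if pivot S.1 l is Some p then (p : nat) else 0%N.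
have Pj : P j by rewrite /P dj.
case: (arg_maxnP pv Pj) => l /andP[dl cl] lmax.
have [p ep] := pivot_nonzero cl; have /pivotP[lp _] := ep.
have : (S.1 *m d) p ord0 = 0 by rewrite (track_mul tS) -mulmxA -ed Ac mxE.
rewrite mxE (bigD1 l) //= big1 ?addr0.
  by move/eqP; rewrite mulf_eq0 (negbTE lp) (negbTE dl).
move=> k kl; have [->|dk] := eqVneq (d k ord0) 0; first by rewrite mulr0.
have [ck|ck] := eqVneq (col k S.1) 0.
  by have /colP/(_ p) := ck; rewrite !mxE => ->; rewrite mul0r.
have [q eq_q] := pivot_nonzero ck; have /pivotP[_ qmax] := eq_q.
have [->|/qmax pq] := eqVneq (S.1 p k) 0; first by rewrite mul0r.
have /lmax : P k by rewrite /P dk.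
rewrite /pv (eqP ep) (eqP eq_q) /= => qp.
have e : q = p by apply/val_inj/eqP; rewrite eqn_leq pq qp.
move: eq_q; rewrite e => eq_q; have := neq_ltn k l; rewrite kl => /esym/orP[h|h].
  by have := irr l k p (dz _ dl) (dz _ dk) h; rewrite ep eq_q.
by have := irr k l p (dz _ dk) (dz _ dl) h; rewrite ep eq_q.
Qed.

End Reduction.

(** * The traversal of the grid *)

Lemma lex_le_trans : transitive lex_le.
Proof. by move=> [a b] [c d] [e f]; rewrite /lex_le /=; lia. Qed.

Lemma lex_le_total : total lex_le.
Proof. by move=> [a b] [c d]; rewrite /lex_le /=; lia. Qed.

Lemma lex_le_anti : antisymmetric lex_le.
Proof. by move=> [a b] [c d]; rewrite /lex_le /= => h; congr (_, _); lia. Qed.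

Lemma lex_le1 z z' : lex_le z z' -> z.1 <= z'.1.
Proof. by rewrite /lex_le; lia. Qed.

Section Traversal.
Variables (K : fieldType) (m n : nat) (A : bigradedMatrix K m n).

(** The part of the span of the output that is available in grade [z]. *)
Definition out_span (out : seq ('cV[K]_n * grade)) (z : grade) :
  {vspace 'cV[K]_n} := <<[seq o.1 | o <- out & gle o.2 z]>>%VS.

Lemma mem_out_span out z v zo :
  (v, zo) \in out -> gle zo z -> v \in out_span out z.
Proof.
move=> vo h; apply: memv_span; apply/mapP; exists (v, zo) => //.
by rewrite mem_filter h.
Qed.

Lemma out_spanS out out' z z' : {subset out <= out'} -> gle z z' ->
  (out_span out z <= out_span out' z')%VS.
Proof.
move=> sub h; apply/span_subvP => _ /mapP[[v zo] + ->].
by rewrite mem_filter /= => /andP[/gle_trans/(_ h) h1 /sub ho]; exact: mem_out_span ho h1.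
Qed.

(** State of the algorithm after the grades of [d]. Only the grades of [d] with
    the current first coordinate are known to be reduced, since moving on to a
    larger first coordinate brings in new columns. Recorded columns vanish, so
    they are final, and every kernel vector supported below a visited grade is
    already spanned by the output. *)
Record invariant (d : seq grade) (s : state K m n) : Prop := Invariant {
  inv_tracking : forall x, (forall z, z \in d -> z.1 <= x) ->
    tracking A x (st_R s, st_V s);
  inv_reduced : forall z, z \in d -> (forall z', z' \in d -> z'.1 <= z.1) ->
    forall j, j \in treated A z ->
    (forall k p, ~~ reducible A z (st_R s) j k p) /\
    (col j (st_R s) = 0 -> exists2 zo, (col j (st_V s), zo) \in output s & gle zo z);
  inv_recorded : forall j, j \in recorded s -> col j (st_R s) = 0 /\
    exists2 zo, zo \in d &
      zo.2 = (label A j).2 /\ (col j (st_V s), zo) \in output s;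
  inv_output : exists L : seq 'I_n, [/\ uniq L, {subset L <= recorded s} &
    [seq o.1 | o <- output s] = [seq col j (st_V s) | j <- L]];
  inv_kernel : forall o, o \in output s ->
    below (label A) o.2 o.1 /\ A *m o.1 = 0;
  inv_span : forall z c, z \in d -> below (label A) z c -> A *m c = 0 ->
    c \in out_span (output s) z
}.

Lemma invariant_init : invariant [::] (init_state A).
Proof.
split=> //=; last by exists [::].
  move=> x _; split=> /= [|j|i j|i j]; first by rewrite mulmx1.
  - by rewrite mxE eqxx.
  - by rewrite mxE; case: (i =P j) => [->|_]; rewrite ?eqxx.
  by rewrite mxE; case: (i =P j) => [-> _|_]; rewrite ?eqxx // le_max lexx orbT.
by move=> j; rewrite inE.
Qed.

(** A column treated at an earlier grade z' of the same first coordinate as z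
    has its second coordinate below that of z, as do all the columns preceding
    it; the pass at z leaves them alone, so what held after z' still does. The
    hypothesis on [rcons d z] says that every column of label at most z was
    treated at a grade of this kind or at z itself. *)
Lemma invariant_step d z s s' :
  (forall z', z' \in d -> lex_le z' z) -> z \notin d ->
  (forall j, (label A j).2 <= z.2 -> (z.1, (label A j).2) \in rcons d z) ->
  invariant d s -> grade_step A z s s' -> invariant (rcons d z) s'.
Proof.
move=> dz zd grd [tr rd rc [L [uL sL eL]] ker sp] [pass [eD eo]].
have fr := pass_frame pass; have fz := pass_zero pass.
have ir := pass_irreducible (treated_sorted _ _) pass.
rewrite /= in fr fz ir.
have t1 : tracking A z.1 (st_R s', st_V s').
  apply: pass_tracking pass _ _ => [j|]; first by rewrite mem_treated => /andP[].
  by apply: tr => z' /dz/lex_le1.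
have sub : {subset output s <= output s'} by move=> o ho; rewrite eo mem_cat ho.
have newP j : j \in newly_zero A z (st_R s') (recorded s) ->
    [/\ j \in treated A z, col j (st_R s') = 0 & j \notin recorded s].
  by rewrite mem_filter => /andP[/andP[/eqP -> ->] ->].
have rc' j : j \in recorded s' -> col j (st_R s') = 0 /\
    exists2 zo, zo \in rcons d z &
      zo.2 = (label A j).2 /\ (col j (st_V s'), zo) \in output s'.
  rewrite eD in_setU inE => /orP[/rc[j0 [zo zod [ezo ho]]]|hj].
    have [-> ->] := fz j j0; split=> //.
    exists zo; first by rewrite mem_rcons inE zod orbT.
    by split=> //; exact: sub.
  have [tj j0 _] := newP j hj; split=> //.
  exists z; first by rewrite mem_rcons mem_head.
  split; first by move: tj; rewrite mem_treated => /andP[_ /eqP].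
  by rewrite eo mem_cat; apply/orP; right; apply/mapP; exists j.
have rd' z' : z' \in rcons d z -> (forall z'', z'' \in rcons d z -> z''.1 <= z'.1) ->
    forall j, j \in treated A z' ->
    (forall k p, ~~ reducible A z' (st_R s') j k p) /\
    (col j (st_R s') = 0 ->
      exists2 zo, (col j (st_V s'), zo) \in output s' & gle zo z').
  rewrite mem_rcons inE => /predU1P[-> _ j jz|z'd zmax j jz].
    split=> [|j0]; first exact: ir.
    have [jr|jr] := boolP (j \in recorded s').
      have [_ [zo zod [ezo ho]]] := rc' j jr; exists zo => //.
      move: jz; rewrite mem_treated => /andP[_ /eqP ej].
      apply/gleP; rewrite ezo ej; split=> //.
      by move: zod; rewrite mem_rcons inE => /predU1P[->|/dz/lex_le1].
    case/negP: jr; rewrite eD in_setU inE; apply/orP.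
    case: (boolP (j \in recorded s)) => jr; [by left|right].
    by rewrite mem_filter j0 eqxx jr.
  have ez : z'.1 = z.1.
    apply/eqP; rewrite eq_le zmax ?mem_rcons ?mem_head // andbT.
    exact: lex_le1 (dz _ z'd).
  have lz : z'.2 < z.2.
    have := dz _ z'd; rewrite /lex_le ez ltxx eqxx /= le_eqVlt => /predU1P[e|//].
    by case/negP: zd; rewrite (_ : z = z') //; case: (z) (z') ez e => ? ? [? ?] /= -> ->.
  have same (k : 'I_n) : (k <= j)%N -> k \notin treated A z.
    move=> /(label_colex A) h; rewrite mem_treated negb_and; apply/orP; right.
    move: jz; rewrite mem_treated => /andP[_ /eqP ej].
    apply: contraTneq lz => ek; move: h; rewrite /colex_le ek ej -leNgt.
    by case/orP => [/ltW //|/andP[/eqP -> _]].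
  have [|rj cj] := rd z' z'd _ j jz.
    by move=> z'' hz''; apply: zmax; rewrite mem_rcons inE hz'' orbT.
  have [eR eV] := fr j (same j (leqnn j)).
  split=> [k p|].
    rewrite (@reducible_ext _ _ _ A z' _ (st_R s)) // => kj; split=> //.
    by case: (fr k (same k (ltnW kj))).
  by rewrite eR eV => /cj[zo ho hzo]; exists zo => //; exact: sub.
have grdT j : gle (label A j) z -> j \in treated A (z.1, (label A j).2) /\
    (z.1, (label A j).2) \in rcons d z.
  by move=> /gleP[j1 j2]; rewrite mem_treated /= j1 eqxx; split=> //; exact: grd.
have zmax z'' : z'' \in rcons d z -> z''.1 <= z.1.
  by rewrite mem_rcons inE => /predU1P[->|/dz/lex_le1].
split=> //.
- by move=> x hx; apply: trackingW t1; apply: hx; rewrite mem_rcons mem_head.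
- exists (L ++ newly_zero A z (st_R s') (recorded s)); split.
  + rewrite cat_uniq uL filter_uniq ?treated_uniq // andbT.
    apply/hasPn => j /newP[_ _]; apply: contra; exact: sL.
  + move=> j; rewrite mem_cat eD in_setU inE => /orP[/sL ->|->] //.
    by rewrite orbT.
  rewrite eo !map_cat eL -!map_comp; congr (_ ++ _).
  by apply/eq_in_map => j /sL/rc[j0 _]; case: (fz j j0) => _ ->.
- move=> o; rewrite eo mem_cat => /orP[/ker //|/mapP[j /newP[tj j0 _] ->]] /=.
  split.
    apply: (tracking_below t1); apply/gleP.
    by move: tj; rewrite mem_treated => /andP[-> /eqP ->].
  by have := track_mul t1; rewrite /= => e; rewrite colE mulmxA -e -colE j0.
move=> z' c; rewrite mem_rcons inE => /predU1P[->|z'd] hc Ac; last first.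
  by apply: (subvP (out_spanS sub (gle_refl z'))); exact: sp.
have [|e ec he] := reduced_kernel t1 _ hc Ac.
  move=> j k p hj hk kj /=; have [jt zt] := grdT j hj.
  have [/(_ k p) + _] := rd' _ zt zmax j jt; rewrite /reducible kj /=.
  have /gleP[k1 _] := hk; have := label_colex A (ltnW kj).
  rewrite /gle k1 /= /colex_le => /orP[/ltW ->|/andP[/eqP -> _]] //.
  by rewrite lexx.
rewrite ec mulmx_sum_col; apply: memv_suml => j _.
have [->|/he[hj j0]] := eqVneq (e j ord0) 0; first by rewrite scale0r mem0v.
apply: memvZ; have [jt zt] := grdT j hj.
have [_ /(_ j0)[zo ho hzo]] := rd' _ zt zmax j jt.
apply: mem_out_span ho (gle_trans hzo _).
by move/gleP: hj => [? ?]; apply/gleP.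
Qed.

Lemma grid_uniq : uniq (grid A).
Proof. by rewrite sort_uniq undup_uniq. Qed.

Lemma mem_grid i j : ((label A i).1, (label A j).2) \in grid A.
Proof. by rewrite mem_sort mem_undup; apply: allpairs_f; exact: codom_f. Qed.

Lemma gridP z : z \in grid A -> exists i, z.1 = (label A i).1.
Proof.
rewrite mem_sort mem_undup => /allpairsP[[a b] /= [/codomP[i ->] _ ->]].
by exists i.
Qed.

Lemma invariant_grid s : for_each (grade_step A) (grid A) (init_state A) s ->
  invariant (grid A) s.
Proof.
have : pairwise lex_le (grid A).
  by rewrite -(sorted_pairwise lex_le_trans) sort_sorted //; exact: lex_le_total.
suff loop l d t : d ++ l = grid A -> pairwise lex_le (d ++ l) ->
    invariant d t -> for_each (grade_step A) l t s -> invariant (grid A) s.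
  by move=> pw; apply: (loop _ [::]) => //; exact: invariant_init.
elim: l d t => [|z l IH] d t eg pw inv /=.
  by move=> ->; rewrite -eg cats0.
case=> u stp; apply: (IH (rcons d z)); rewrite ?cat_rcons //.
have := grid_uniq; rewrite -eg cat_uniq /= negb_or => /and3P[_ /andP[zd _] _].
move: (pw); rewrite pairwise_cat /= => /and3P[/allrelP dl _ /andP[/allP zl _]].
apply: (invariant_step _ _ _ inv stp) => //.
  by move=> z' z'd; apply: dl; rewrite ?mem_head.
move=> j jz; have zg : z \in grid A by rewrite -eg mem_cat mem_head orbT.
have [i ei] := gridP zg; have := mem_grid i j; rewrite -ei -eg.
rewrite mem_cat inE mem_rcons inE => /or3P[->|->|/zl h]; rewrite ?orbT //.
suff -> : (z.1, (label A j).2) = z by rewrite eqxx.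
by apply/lex_le_anti; rewrite h andbT /lex_le /= eqxx jz orbT.
Qed.

(** Moving [z] down to the join of the labels in the support of [c] does not
    affect the condition on [c], and lands in the grid. *)
Lemma grid_support z (c : 'cV[K]_n) : c != 0 -> below (label A) z c ->
  exists2 z', z' \in grid A & gle z' z /\ below (label A) z' c.
Proof.
move=> c0 hc; have [i0 hi0] : exists i, c i ord0 != 0.
  apply/existsP; apply: contraR c0; rewrite negb_exists => /forallP h.
  by apply/eqP/colP => i; rewrite mxE; apply/eqP/negPn.
pose P i := c i ord0 != 0; have Pi0 : P i0 := hi0.
have PT i : P i -> gle (label A i) z by move=> h; apply: contraR h => /hc ->.
have [i Pi imax] := @Order.TotalTheory.arg_maxP _ _ _ i0 P (fun i => (label A i).1) Pi0.
have [j Pj jmax] := @Order.TotalTheory.arg_maxP _ _ _ i0 P (fun i => (label A i).2) Pi0.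
exists ((label A i).1, (label A j).2); first exact: mem_grid.
have /gleP[i1 _] := PT _ Pi; have /gleP[_ j2] := PT _ Pj.
split; first exact/gleP.
by move=> k; apply: contraNeq => Pk; apply/gleP; split; [exact: imax|exact: jmax].
Qed.

Lemma unit_cols_indep p (V : 'M[K]_n) (l : 'I_p -> 'I_n) (a : 'I_p -> K) :
  V \in unitmx -> injective l -> \sum_k a k *: col (l k) V = 0 ->
  forall k, a k = 0.
Proof.
move=> uV il e k.
have : invmx V *m \sum_k a k *: col (l k) V = \sum_k a k *: delta_mx (l k) ord0.
  rewrite mulmx_sumr; apply: eq_bigr => q _.
  by rewrite -scalemxAr colE mulKmx.
rewrite e mulmx0 => /esym/matrixP/(_ (l k) ord0).
rewrite summxE (bigD1 k) //= !mxE !eqxx mulr1 big1 ?addr0 // => q qk.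
by rewrite !mxE (inj_eq il) eq_sym (negbTE qk) mulr0.
Qed.

(** Generation is claimed at every grade, whether or not it lies in the grid;
    linear independence over K is what makes the generators minimal. *)
Theorem KerBasis_correct out : KerBasis A out ->
  let o i := tnth (in_tuple out) i in
  [/\ forall i, below (label A) (o i).2 (o i).1 /\ A *m (o i).1 = 0,
      forall a : 'I_(size out) -> K,
        \sum_i a i *: (o i).1 = 0 -> forall i, a i = 0 &
      forall z c, below (label A) z c -> A *m c = 0 -> c \in out_span out z].
Proof.
case=> s /invariant_grid [tr _ _ [L [uL _ eL]] ker sp] <- o; split.
- by move=> i; apply: ker; exact: mem_tnth.
- have [x hx] : exists x, forall z, z \in grid A -> z.1 <= x.
    elim: (grid A) => [|z l [x hx]]; first by exists 0.
    exists (Num.max z.1 x) => z'; rewrite inE le_max => /predU1P[->|/hx ->].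
      by rewrite lexx.
    by rewrite orbT.
  have uV := tracking_unit (tr x hx); rewrite /= in uV.
  have esz : size (output s) = size L by rewrite -(size_map fst) eL size_map.
  pose l k := tnth (in_tuple L) (cast_ord esz k).
  have il : injective l.
    by move=> k k' /(tuple_uniqP (in_tuple L) uL)/cast_ord_inj.
  have oE i : (o i).1 = col (l i) (st_V s).
    have iL : (i < size L)%N by rewrite -esz ltn_ord.
    rewrite /o (tnth_nth (0, (0, 0))) /= -(nth_map _ 0 fst) // eL.
    by rewrite (nth_map (l i)) // {2}/l (tnth_nth (l i)).
  move=> a e; apply: unit_cols_indep uV il _.
  by rewrite -[RHS]e; apply: eq_bigr => i _; rewrite oE.
move=> z c hc Ac; have [->|c0] := eqVneq c 0; first exact: mem0v.
have [z' z'g [zz hc']] := grid_support c0 hc.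
by apply: (subvP (out_spanS _ zz)) (sp _ _ z'g hc' Ac).
Qed.

Theorem KerBasis_terminates : exists out, KerBasis A out.
Proof.
have tot T S (step : T -> S -> S -> Prop) : (forall x s, exists s', step x s s') ->
    forall l s, exists s', for_each step l s s'.
  move=> h; elim=> [|x l IH] s; first by exists s.
  by have [t ht] := h x s; have [s' hs'] := IH t; exists s', t.
have stp z s : exists s', grade_step A z s s'.
  have [[R V] hRV] := tot _ _ (reduce_col A z) (@reduce_col_total _ _ _ A z)
    (treated A z) (st_R s, st_V s).
  pose new := newly_zero A z R (recorded s).
  by exists (State R V (recorded s :|: [set j in new])
    (output s ++ [seq (col j V, z) | j <- new])).
have [s hs] := tot _ _ (grade_step A) stp (grid A) (init_state A).
by exists (output s), s.
Qed.

End Traversal.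

(** * From coordinates to the kernel *)

Lemma span_ind (K : fieldType) (vT : vectType K) (X : seq vT) (Q : vT -> Prop) :
  Q 0 -> (forall a u v, u \in X -> Q v -> Q (a *: u + v)) ->
  forall v, v \in <<X>>%VS -> Q v.
Proof.
move=> Q0 QD v /(coord_span (X := in_tuple X)) ->.
by apply: (big_rec Q) => // i w _; apply: QD; rewrite mem_nth.
Qed.

Section Kernel.
Variables (K : fieldType) (F F' : bipersModule K) (gamma : bipersMor F F').
Variables (m n : nat) (gr : 'I_n -> grade) (B : 'I_n -> F).
Variables (gr' : 'I_m -> grade) (B' : 'I_m -> F') (A : bigradedMatrix K m n).
Hypothesis (regF : regular F) (regF' : regular F').
Hypothesis (basisB : is_basis gr B) (basisB' : is_basis gr' B').
Hypothesis matA : mor_matrix gamma gr B gr' B' A.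

(** The matrix acts on coordinate vectors of any grade, because the shift
    from the label of a column to [z] commutes with taking coordinates. *)
Lemma mor_combo z c : below gr z c ->
  below gr' z (A *m c) /\ gamma (combo gr B z c) = combo gr' B' z (A *m c).
Proof.
move=> hc.
have hcol j : gle (gr j) z -> below gr' z (col j A).
  by move=> h; have [_ [+ _]] := matA j; exact: belowW.
split.
  rewrite mulmx_sum_col => i hi; rewrite summxE big1 // => j _; rewrite mxE.
  have [/hcol->|/hc->] := boolP (gle (gr j) z); by rewrite ?mulr0 ?mul0r.
rewrite {1}/combo linear_sum mulmx_sum_col combo_sum big_mkcond /=.
apply: eq_bigr => j _; case: (boolP (gle _ _)) => h; last first.
  by rewrite hc // scale0r combo0.
have [_ [hj ej]] := matA j.
rewrite linearZ comboZ (combo_shift _ h hj) -[combo _ _ (gr j) _]ej.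
by rewrite scalerA mul_mpolyC.
Qed.

Lemma ker_combo z c : below gr z c ->
  (combo gr B z c \in kerpred gamma) = (A *m c == 0).
Proof.
move=> /mor_combo[hA e]; rewrite unfold_in e.
apply/eqP/eqP => [|->]; last exact: combo0.
exact: relation_trivial.
Qed.

Lemma below_label z (c : 'cV[K]_n) : below (label A) z c <-> below gr z c.
Proof. by split=> h i hi; apply: h; have [e _] := matA i; rewrite ?e // -e. Qed.

(** Both generation and minimality are checked one grade at a time, where they
    become statements on coordinate vectors. *)
Theorem KerBasis_represents out : KerBasis A out ->
  represents_ker_basis gamma gr B out.
Proof.
rewrite /represents_ker_basis => /KerBasis_correct /=.
set o := tnth (in_tuple out) => -[ker indep span].
pose b i : bker gamma :=
  insubd (0 : kercar gamma) (combo gr B (o i).2 (o i).1).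
have hB i : piece (gr i) (B i) by case: basisB.
have hbel i : below gr (o i).2 (o i).1 by apply/below_label; case: (ker i).
have valb i : val (b i : kercar gamma) = combo gr B (o i).2 (o i).1.
  by rewrite val_insubd ker_combo //; case: (ker i) => _ ->; rewrite eqxx.
have homb i : piece (o i).2 (b i).
  by rewrite /= /ker_piece valb; exact: combo_piece.
have valZ p (u : bker gamma) :
    val (p *: u : kercar gamma) = p *: val (u : kercar gamma) by [].
exists b; split; first by move=> i; split; [exact: hbel|exact: valb].
split=> // [v|X gen].
  pose gens (w : bker gamma) := exists p : 'I_(size out) -> {mpoly K[2]},
    w = \sum_(i in setT) p i *: b i.
  have gens0 : gens 0.
    by exists (fun=> 0); rewrite big1 // => i _; rewrite scale0r.
  have gensD u w : gens u -> gens w -> gens (u + w).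
    move=> [p ->] [q ->]; exists (fun i => p i + q i); rewrite -big_split.
    by apply: eq_bigr => i _; rewrite scalerDl.
  have gensb a i : gens (a *: b i).
    exists (fun j => if j == i then a else 0); rewrite (bigD1 i) //= eqxx.
    by rewrite big1 ?addr0 // => j /andP[_ /negbTE ->]; rewrite scale0r.
  have [s [c [_ hc ->]]] := piece_span v.
  apply: (big_ind gens) => // z _.
  have [|d [hd _ ed]] := hom_generates hB (A := setT) _ (hc z); first by case: basisB.
  have Ad : A *m d = 0.
    by apply/eqP; rewrite -(ker_combo hd) -ed; exact: (valP (c z : kercar gamma)).
  have := span z d (iffRL (below_label z d) hd) Ad.
  suff : forall e, e \in out_span out z ->
      exists2 w, gens w & combo gr B z e = val (w : kercar gamma).
    move=> h /h [w gw ew]; rewrite (_ : c z = w) //.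
    by apply/val_inj; rewrite -ew -ed.
  apply: span_ind => [|a u w /mapP[x]].
    by exists 0 => //; rewrite combo0.
  rewrite mem_filter => /andP[xz /(nthP x)[k kout ex]] eu [w' gw' ew'].
  pose i := Ordinal kout; have oi : o i = x by rewrite /o (tnth_nth x).
  exists ((a *: 'X_[gdiff (o i).2 z]) *: b i + w'); first exact: gensD.
  rewrite comboP eu -oi ew' raddfD; congr (_ + _).
  rewrite [RHS](valZ _ (b i)) valb -mul_mpolyC -scalerA.
  by rewrite -combo_shift // oi.
(* If [b i] were redundant, comparing coordinates in [B] would express the
   vector of [b i] by the other vectors of the output. *)
apply/setP => i; rewrite inE; apply/negPn/negP => iX.
have [c [hc c0 ec]] := hom_generates homb gen (homb i).
have rel : (o i).1 = \sum_k c k ord0 *: (o k).1.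
  apply: (coord_inj regF basisB (z := (o i).2)) => //.
    move=> j hj; rewrite summxE big1 // => k _; rewrite mxE.
    case: (boolP (gle (o k).2 (o i).2)) => h.
      by rewrite (belowW h (hbel k)) ?mulr0.
    by rewrite hc // mul0r.
  rewrite -valb {1}ec /combo raddf_sum -/(combo _ _ _ _) combo_sum big_mkcond.
  apply: eq_bigr => k _; case: (boolP (gle _ _)) => h; last first.
    by rewrite hc // scale0r combo0.
  rewrite [LHS](valZ _ (b k)) valb comboZ (combo_shift B h (hbel k)).
  by rewrite scalerA mul_mpolyC.
have /(indep (fun k => (k == i)%:R - c k ord0))/(_ i) : 
    \sum_k ((k == i)%:R - c k ord0) *: (o k).1 = 0.
  under eq_bigr do rewrite scalerBl.
  rewrite sumrB -rel (bigD1 i) //= eqxx scale1r big1 ?addr0 ?subrr //.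
  by move=> k /negbTE ->; rewrite scale0r.
by rewrite eqxx c0 // subr0 => /eqP; rewrite oner_eq0.
Qed.

End Kernel.

Theorem proposition3p4 (K : fieldType) (F F' : bipersModule K)
    (gamma : bipersMor F F') (m n : nat)
    (gr : 'I_n -> grade) (B : 'I_n -> F)
    (gr' : 'I_m -> grade) (B' : 'I_m -> F')
    (A : bigradedMatrix K m n) :
  is_free F -> is_free F' ->
  is_basis gr B -> is_basis gr' B' ->
  mor_matrix gamma gr B gr' B' A ->
  is_free (bker gamma) /\
  (exists out, KerBasis A out) /\
  (forall out, KerBasis A out -> represents_ker_basis gamma gr B out).
Proof.
move=> /free_regular regF /free_regular regF' basisB basisB' matA.
have rep := KerBasis_represents regF regF' basisB basisB' matA.
have [out outP] := KerBasis_terminates A.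
split; last by split=> //; exists out.
have [b [_ basis_b]] := rep _ outP.
exact: basis_free (ker_regular gamma regF regF') basis_b.
Qed.
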